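(* Let $k\in\mathbb N$ and $f\in\mathcal R^0_{[1]}(\mathbb R^2)$. Then $f\in\mathcal R^k_{[1]}(\mathbb R^2)$ if and only if $f$ has a polynomial expansion of order $k$ at every point of $\mathbb R^2$, i.e. for every $a\in\mathbb R^2$ there is a polynomial $P_k\in\mathbb R[x,y]$ of degree at most $k$ such that $f(a+h)=f(a)+P_k(h)+o(\|h\|^k)$ as $h\to 0$.
   Context: For $k\in\mathbb N\cup\{\infty\}$, $\mathcal R^k(\mathbb R^2)$ denotes the ring of functions $f:\mathbb R^2\to\mathbb R$ of class $C^k$ that coincide with $p/q$ ($p,q$ polynomials, $q$ nonvanishing there) on some nonempty Zariski open set. For $l\in\mathbb N$: consider compositions $\pi:M\to\mathbb R^2$ of successive blowings-up $M_i\to M_{i-1}$ ($M_0=\mathbb R^2$), each centred at points. An infinitely near point of order $j$ is a sequence $a_0\in M_0,\dots,a_j\in M_j$ where $M_i$ is the blowing-up of $M_{i-1}$ at $a_{i-1}$ and $a_i$ maps to $a_{i-1}$; the number of stages of $\pi$ is the maximal order of infinitely near points in $M$. $\mathcal R^k_{[l]}(\mathbb R^2)$ is the set of $f\in\mathcal R^k(\mathbb R^2)$ for which there is such a $\pi$ with at most $l$ stages such that $f\circ\pi$ is regular on $M$. *)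

(* Defs.v *)
From Stdlib Require Import Reals List.
Open Scope R_scope.

Definition is_poly2_deg (d : nat) (P : R -> R -> R) : Prop :=
  exists c : nat -> nat -> R,
    (forall i j : nat, (d < i + j)%nat -> c i j = 0) /\
    (forall x y : R,
        P x y = sum_f_R0 (fun i => sum_f_R0 (fun j => c i j * x ^ i * y ^ j) d) d).

Definition is_poly2 (P : R -> R -> R) : Prop := exists d : nat, is_poly2_deg d P.

Definition cont2 (f : R -> R -> R) : Prop :=
  forall x y eps, 0 < eps -> exists delta, 0 < delta /\
    forall x' y', Rabs (x' - x) < delta -> Rabs (y' - y) < delta ->
      Rabs (f x' y' - f x y) < eps.

Fixpoint Ck (k : nat) (f : R -> R -> R) : Prop :=
  match k with
  | O => cont2 f
  | S k' => cont2 f /\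
      exists fx fy : R -> R -> R,
        (forall x y, derivable_pt_lim (fun t => f t y) x (fx x y)) /\
        (forall x y, derivable_pt_lim (fun t => f x t) y (fy x y)) /\
        Ck k' fx /\ Ck k' fy
  end.

(* R^k(R^2): C^k functions coinciding with p/q on a nonempty Zariski open set
   (it suffices to take a nonempty basic open set {r <> 0}). *)
Definition regulous (k : nat) (f : R -> R -> R) : Prop :=
  Ck k f /\
  exists p q r : R -> R -> R,
    is_poly2 p /\ is_poly2 q /\ is_poly2 r /\
    (exists x y, r x y <> 0) /\
    (forall x y, r x y <> 0 -> q x y <> 0 /\ f x y = p x y / q x y).

(* g is regular on the (Zariski open) subset U of R^2: at every point of U it
   equals p/q (q nonvanishing) on a Zariski neighbourhood U /\ {r <> 0}. *)
Definition regular_on (U : R -> R -> Prop) (g : R -> R -> R) : Prop :=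
  forall x y, U x y ->
    exists p q r : R -> R -> R,
      is_poly2 p /\ is_poly2 q /\ is_poly2 r /\ r x y <> 0 /\
      (forall u v, U u v -> r u v <> 0 -> q u v <> 0 /\ g u v = p u v / q u v).

(* Standard affine charts of the blowing-up of R^2 at the point a. *)
Definition chart1 (a : R * R) (u v : R) : R * R := (fst a + u, snd a + u * v).
Definition chart2 (a : R * R) (u v : R) : R * R := (fst a + u * v, snd a + v).

(* Domain of a chart at a inside the blowing-up of R^2 at the finite set S:
   exclude the preimages of the other centres. *)
Definition chart_dom (S : list (R * R)) (a : R * R)
    (ch : R * R -> R -> R -> R * R) (u v : R) : Prop :=
  forall b, In b S -> b <> a -> ch a u v <> b.

(* f o pi is regular on M, where pi : M -> R^2 is the blowing-up of R^2 at the
   finite set of points S (one stage); M is covered by R^2 \ S and the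
   two standard charts above each a in S. *)
Definition blowup_regular (S : list (R * R)) (f : R -> R -> R) : Prop :=
  regular_on (fun x y => ~ In (x, y) S) f /\
  (forall a, In a S ->
     regular_on (chart_dom S a chart1)
       (fun u v => f (fst (chart1 a u v)) (snd (chart1 a u v))) /\
     regular_on (chart_dom S a chart2)
       (fun u v => f (fst (chart2 a u v)) (snd (chart2 a u v)))).

Definition regulous1 (k : nat) (f : R -> R -> R) : Prop :=
  regulous k f /\ exists S : list (R * R), blowup_regular S f.

Definition has_poly_expansion (k : nat) (f : R -> R -> R) (a1 a2 : R) : Prop :=
  exists P : R -> R -> R, is_poly2_deg k P /\
    forall eps, 0 < eps -> exists delta, 0 < delta /\
      forall h1 h2, 0 < sqrt (h1 ^ 2 + h2 ^ 2) < delta ->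
        Rabs (f (a1 + h1) (a2 + h2) - f a1 a2 - P h1 h2)
          <= eps * (sqrt (h1 ^ 2 + h2 ^ 2)) ^ k.

(* Main.v *)
(* For the direct implication, Taylor's formula is obtained by integrating the
   expansions of the partial derivatives along the sides of a rectangle.

   For the converse, subtract from f the polynomial Q of its expansion at a
   blown-up point a.  In a chart (u, v) |-> a + (u, u v), the pullback of f - Q
   is rational with denominator nonzero near each point of u = 0, and it is
   o(u^k) for every fixed v; hence its numerator is divisible by u^(k+1).  Thus
   f - Q = u^(k+1) G(u, v) with G regular, and each partial derivative lowers
   the exponent of u by only one.  As long as the exponent is positive, such a
   function is continuous at a (by compactness of the exceptional divisor), so
   f is of class C^k at a.  At the other points f is regular. *)
Require Import Defs.
From Stdlib Require Import Reals List Lra Lia Classical IndefiniteDescription.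
From Coquelicot Require Import Coquelicot.
Open Scope R_scope.

(** * Polynomials of bounded degree *)

(** Generators replace coefficient arrays, so that closure properties follow by induction;
    [polyd_ext] makes the class stable under pointwise equality. *)
Inductive polyd (d : nat) : (R -> R -> R) -> Prop :=
| polyd_mono c i j : (i + j <= d)%nat -> polyd d (fun x y => c * x ^ i * y ^ j)
| polyd_add P Q : polyd d P -> polyd d Q -> polyd d (fun x y => P x y + Q x y)
| polyd_ext P Q : polyd d P -> (forall x y, Q x y = P x y) -> polyd d Q.

Lemma polyd_const d c : polyd d (fun _ _ => c).
Proof.
  apply (polyd_ext d (fun x y => c * x ^ 0 * y ^ 0)).
  - apply polyd_mono; lia.
  - intros; simpl; ring.
Qed.

Lemma polyd_sum d n (F : nat -> R -> R -> R) :
  (forall i, polyd d (F i)) ->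
  polyd d (fun x y => sum_f_R0 (fun i => F i x y) n).
Proof.
  intros HF; induction n as [|n IH]; simpl.
  - apply HF.
  - now apply (polyd_add d _ (F (S n))).
Qed.

Lemma is_poly2_deg_polyd d P : is_poly2_deg d P -> polyd d P.
Proof.
  intros [c [Hc HP]]; eapply polyd_ext; [|exact HP].
  apply (polyd_sum d d
    (fun i x y => sum_f_R0 (fun j => c i j * x ^ i * y ^ j) d)); intros i.
  apply (polyd_sum d d (fun j x y => c i j * x ^ i * y ^ j)); intros j.
  destruct (Nat.le_gt_cases (i + j) d) as [H|H].
  - now apply polyd_mono.
  - apply (polyd_ext d (fun _ _ => 0)); [apply polyd_const|].
    intros; rewrite Hc by assumption; ring.
Qed.

Lemma sum_f_R0_single (F : nat -> R) i n :
  (i <= n)%nat -> (forall k, k <> i -> F k = 0) -> sum_f_R0 F n = F i.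
Proof.
  intros Hi HF; induction n as [|n IH]; simpl.
  - now replace i with 0%nat by lia.
  - destruct (Nat.eq_dec i (S n)) as [->|Hn].
    + rewrite (sum_eq _ (fun _ => 0)) by (intros; apply HF; lia).
      rewrite sum_cte; ring.
    + rewrite IH, (HF (S n)) by lia; ring.
Qed.

Lemma polyd_is_poly2_deg d P : polyd d P -> is_poly2_deg d P.
Proof.
  induction 1 as [c i j Hij|P Q _ [a [Ha HP]] _ [b [Hb HQ]]|P Q _ [c [Hc HP]] HPQ].
  - exists (fun i' j' => if Nat.eq_dec i' i then
                           if Nat.eq_dec j' j then c else 0 else 0); split.
    + intros i' j' H.
      destruct (Nat.eq_dec i' i), (Nat.eq_dec j' j); try reflexivity; lia.
    + intros x y; rewrite (sum_f_R0_single _ i); [|lia|].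
      * rewrite (sum_f_R0_single _ j); [|lia|].
        -- destruct (Nat.eq_dec i i), (Nat.eq_dec j j); now try lia.
        -- intros k Hk; destruct (Nat.eq_dec i i), (Nat.eq_dec k j);
             try lia; ring.
      * intros k Hk; rewrite (sum_eq _ (fun _ => 0)); [rewrite sum_cte; ring|].
        intros l _; destruct (Nat.eq_dec k i); [lia|ring].
  - exists (fun i j => a i j + b i j); split.
    + intros i j H; rewrite Ha, Hb by assumption; ring.
    + intros x y; rewrite HP, HQ, <- sum_plus.
      apply sum_eq; intros i _; rewrite <- sum_plus.
      apply sum_eq; intros j _; ring.
  - exists c; split; [assumption|]; intros; now rewrite HPQ.
Qed.

Lemma polyd_at_x0 d P : polyd d P -> polyd d (fun _ y => P 0 y).
Proof.
  induction 1 as [c i j Hij|P Q _ HP _ HQ|P Q _ HP HPQ].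
  - destruct i as [|i].
    + eapply polyd_ext; [exact (polyd_mono d c 0 j Hij)|reflexivity].
    + apply (polyd_ext d (fun _ _ => 0)); [apply polyd_const|].
      intros; simpl; ring.
  - exact (polyd_add d _ _ HP HQ).
  - exact (polyd_ext d _ _ HP (fun _ => HPQ 0)).
Qed.

Lemma polyd_swap d P : polyd d P -> polyd d (fun x y => P y x).
Proof.
  induction 1 as [c i j Hij|P Q _ HP _ HQ|P Q _ HP HPQ].
  - apply (polyd_ext d (fun x y => c * x ^ j * y ^ i)); [|intros; ring].
    apply polyd_mono; lia.
  - exact (polyd_add d _ _ HP HQ).
  - exact (polyd_ext d _ _ HP (fun x y => HPQ y x)).
Qed.

(** Monomials are integrated one by one. Vanishing on x = 0 makes the primitive contribute nothing
    at the start of each side of the Taylor path. *)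
Lemma polyd_primitive_x d P : polyd d P ->
  exists A, polyd (S d) A /\ (forall y, A 0 y = 0) /\
    forall x y, is_derive (fun t => A t y) x (P x y).
Proof.
  induction 1 as [c i j Hij|P Q _ [A [HA [A0 A1]]] _ [B [HB [B0 B1]]]
                 |P Q _ [A [HA [A0 A1]]] HPQ].
  - exists (fun x y => c / INR (S i) * x ^ S i * y ^ j); split; [|split].
    + apply polyd_mono; lia.
    + intros y; simpl; ring.
    + intros x y; auto_derive; [trivial|].
      simpl pred; field; apply (not_0_INR (S i)); lia.
  - exists (fun x y => A x y + B x y); split; [|split].
    + now apply polyd_add.
    + intros y; rewrite A0, B0; ring.
    + intros x y; exact (is_derive_plus _ _ _ _ _ (A1 x y) (B1 x y)).
  - exists A; split; [|split]; try assumption; intros; now rewrite HPQ.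
Qed.

(** * Taylor expansion of C^k functions *)

Definition norm2 (x y : R) : R := sqrt (x ^ 2 + y ^ 2).

Lemma norm2_pos x y : 0 <= norm2 x y.
Proof. apply sqrt_pos. Qed.

Lemma norm2_le x y x' y' :
  Rabs x <= Rabs x' -> Rabs y <= Rabs y' -> norm2 x y <= norm2 x' y'.
Proof.
  intros Hx Hy; apply sqrt_le_1_alt.
  rewrite <- (pow2_abs x), <- (pow2_abs y), <- (pow2_abs x'), <- (pow2_abs y').
  apply Rplus_le_compat; apply pow_incr; split; auto using Rabs_pos.
Qed.

Lemma Rabs_le_norm2_l x y : Rabs x <= norm2 x y.
Proof.
  rewrite <- (sqrt_pow2 (Rabs x)) by apply Rabs_pos.
  apply sqrt_le_1_alt; rewrite pow2_abs; nra.
Qed.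

Lemma norm2_sym x y : norm2 x y = norm2 y x.
Proof. unfold norm2; f_equal; ring. Qed.

Lemma Rabs_le_norm2_r x y : Rabs y <= norm2 x y.
Proof. rewrite norm2_sym; apply Rabs_le_norm2_l. Qed.

(* Integrating the expansions of [fx] and [fy] along the path
   (0,0) -- (0,h2) -- (h1,h2) avoids the symmetry of second derivatives. *)
Lemma Ck_taylor k f a1 a2 : Ck k f ->
  exists P, polyd k P /\
    forall eps, 0 < eps -> exists delta, 0 < delta /\
      forall h1 h2, norm2 h1 h2 < delta ->
        Rabs (f (a1 + h1) (a2 + h2) - P h1 h2) <= eps * norm2 h1 h2 ^ k.
Proof.
  revert f; induction k as [|k IH]; intros f Hf.
  - exists (fun _ _ => f a1 a2); split; [apply polyd_const|].
    intros eps He; destruct (Hf a1 a2 eps He) as [d [Hd H]].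
    exists d; split; [assumption|]; intros h1 h2 Hh; simpl; rewrite Rmult_1_r.
    apply Rlt_le, H.
    + replace (a1 + h1 - a1) with h1 by ring.
      eapply Rle_lt_trans; [apply Rabs_le_norm2_l|exact Hh].
    + replace (a2 + h2 - a2) with h2 by ring.
      eapply Rle_lt_trans; [apply Rabs_le_norm2_r|exact Hh].
  - destruct Hf as [_ [fx [fy [Dx [Dy [Cx Cy]]]]]].
    destruct (IH fx Cx) as [Px [HPx Ex]], (IH fy Cy) as [Py [HPy Ey]].
    destruct (polyd_primitive_x _ _ HPx) as [A [HA [A0 A1]]].
    destruct (polyd_primitive_x _ _ (polyd_swap _ _ HPy)) as [B [HB [B0 B1]]].
    (* [B] is a primitive of [Py] with its variables exchanged, so [B y 0] integrates [Py] along x =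
       0; [A] integrates [Px] along the horizontal side. *)
    exists (fun x y => A x y + (B y 0 + f a1 a2)); split.
    { apply (polyd_add _ A); [assumption|].
      apply (polyd_add _ (fun _ y => B y 0)); [|apply polyd_const].
      exact (polyd_at_x0 _ _ (polyd_swap _ _ HB)). }
    intros eps He.
    destruct (Ex (eps / 2)) as [dx [Hdx Hx]]; [lra|].
    destruct (Ey (eps / 2)) as [dy [Hdy Hy]]; [lra|].
    exists (Rmin dx dy); split; [now apply Rmin_glb_lt|].
    intros h1 h2 Hh.
    pose proof (Rmin_l dx dy); pose proof (Rmin_r dx dy).
    pose proof (norm2_pos h1 h2) as Hn.
    pose proof (pow_le _ k Hn) as Hnk.
    (* Mean value inequality on the horizontal side: the derivative is the remainder of [fx], and
       every point of the side has norm at most that of (h1, h2). Each side accounts for half of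
       [eps]. *)
    assert (V1 : Rabs ((f (a1 + h1) (a2 + h2) - A h1 h2)
                       - (f (a1 + 0) (a2 + h2) - A 0 h2))
                 <= eps / 2 * norm2 h1 h2 ^ k * Rabs (h1 - 0)).
    { apply (bounded_variation (fun t => f (a1 + t) (a2 + h2) - A t h2)
               (fun t => fx (a1 + t) (a2 + h2) - Px t h2)).
      intros t Ht; rewrite !Rminus_0_r in Ht; split.
      - apply (is_derive_minus (fun t => f (a1 + t) (a2 + h2))); [|apply A1].
        replace (fx (a1 + t) (a2 + h2)) with (1 * fx (a1 + t) (a2 + h2)) by ring.
        apply (is_derive_comp (fun s => f s (a2 + h2)) (fun t => a1 + t)).
        + apply is_derive_Reals, Dx.
        + auto_derive; [trivial|ring].
      - assert (L : norm2 t h2 <= norm2 h1 h2) by (apply norm2_le; lra).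
        eapply Rle_trans; [apply Hx; lra|].
        apply Rmult_le_compat_l; [lra|].
        apply pow_incr; split; [apply norm2_pos|exact L]. }
    assert (V2 : Rabs ((f a1 (a2 + h2) - B h2 0) - (f a1 (a2 + 0) - B 0 0))
                 <= eps / 2 * norm2 h1 h2 ^ k * Rabs (h2 - 0)).
    { apply (bounded_variation (fun t => f a1 (a2 + t) - B t 0)
               (fun t => fy a1 (a2 + t) - Py 0 t)).
      intros t Ht; rewrite !Rminus_0_r in Ht; split.
      - apply (is_derive_minus (fun t => f a1 (a2 + t))); [|apply B1].
        replace (fy a1 (a2 + t)) with (1 * fy a1 (a2 + t)) by ring.
        apply (is_derive_comp (fun s => f a1 s) (fun t => a2 + t)).
        + apply is_derive_Reals, Dy.
        + auto_derive; [trivial|ring].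
      - assert (L : norm2 0 t <= norm2 h1 h2).
        { apply norm2_le; [rewrite Rabs_R0; apply Rabs_pos|lra]. }
        rewrite <- (Rplus_0_r a1) at 1.
        eapply Rle_trans; [apply Hy; lra|].
        apply Rmult_le_compat_l; [lra|].
        apply pow_incr; split; [apply norm2_pos|exact L]. }
    rewrite A0, Rplus_0_r, !Rminus_0_r in V1.
    rewrite B0, Rplus_0_r, !Rminus_0_r in V2.
    pose proof (Rabs_le_norm2_l h1 h2) as N1.
    pose proof (Rabs_le_norm2_r h1 h2) as N2.
    replace (f (a1 + h1) (a2 + h2) - (A h1 h2 + (B h2 0 + f a1 a2)))
      with ((f (a1 + h1) (a2 + h2) - A h1 h2 - f a1 (a2 + h2))
            + (f a1 (a2 + h2) - B h2 0 - f a1 a2)) by ring.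
    eapply Rle_trans; [apply Rabs_triang|].
    assert (Hc : 0 <= eps / 2 * norm2 h1 h2 ^ k) by nra.
    pose proof (Rmult_le_compat_l _ _ _ Hc N1).
    pose proof (Rmult_le_compat_l _ _ _ Hc N2).
    simpl; lra.
Qed.

Lemma Ck_has_poly_expansion k f a1 a2 : Ck k f -> has_poly_expansion k f a1 a2.
Proof.
  intros Hf; destruct (Ck_taylor k f a1 a2 Hf) as [P [HP E]].
  exists (fun x y => P x y + - f a1 a2); split.
  - apply polyd_is_poly2_deg, polyd_add; [assumption|apply polyd_const].
  - intros eps He; destruct (E eps He) as [d [Hd H]].
    exists d; split; [assumption|]; intros h1 h2 Hh.
    replace (f (a1 + h1) (a2 + h2) - f a1 a2 - (P h1 h2 + - f a1 a2))
      with (f (a1 + h1) (a2 + h2) - P h1 h2) by ring.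
    now apply H.
Qed.

(** * Polynomial expressions *)

(** A syntax for polynomials: formal derivatives and substitutions are computed by recursion and
    stay polynomial, with no degree to track. *)
Inductive pexp : Type :=
| PC (c : R)
| PX
| PY
| PAdd (e1 e2 : pexp)
| PMul (e1 e2 : pexp).

Fixpoint ev (e : pexp) (x y : R) : R :=
  match e with
  | PC c => c
  | PX => x
  | PY => y
  | PAdd e1 e2 => ev e1 x y + ev e2 x y
  | PMul e1 e2 => ev e1 x y * ev e2 x y
  end.

Fixpoint dX (e : pexp) : pexp :=
  match e with
  | PC _ => PC 0
  | PX => PC 1
  | PY => PC 0
  | PAdd e1 e2 => PAdd (dX e1) (dX e2)
  | PMul e1 e2 => PAdd (PMul (dX e1) e2) (PMul e1 (dX e2))
  end.

Fixpoint dY (e : pexp) : pexp :=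
  match e with
  | PC _ => PC 0
  | PX => PC 0
  | PY => PC 1
  | PAdd e1 e2 => PAdd (dY e1) (dY e2)
  | PMul e1 e2 => PAdd (PMul (dY e1) e2) (PMul e1 (dY e2))
  end.

Fixpoint psubst (e ex ey : pexp) : pexp :=
  match e with
  | PC c => PC c
  | PX => ex
  | PY => ey
  | PAdd e1 e2 => PAdd (psubst e1 ex ey) (psubst e2 ex ey)
  | PMul e1 e2 => PMul (psubst e1 ex ey) (psubst e2 ex ey)
  end.

Definition pswap (e : pexp) : pexp := psubst e PY PX.

Lemma ev_psubst e ex ey x y :
  ev (psubst e ex ey) x y = ev e (ev ex x y) (ev ey x y).
Proof. induction e; simpl; congruence. Qed.

Lemma ev_pswap e x y : ev (pswap e) x y = ev e y x.
Proof. exact (ev_psubst e PY PX x y). Qed.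

(** This commutation and the next let the second chart be treated as the first chart of the function
    with exchanged variables. *)
Lemma dX_pswap e : dX (pswap e) = pswap (dY e).
Proof. unfold pswap; induction e; simpl; congruence. Qed.

Lemma dY_pswap e : dY (pswap e) = pswap (dX e).
Proof. unfold pswap; induction e; simpl; congruence. Qed.

Lemma polyd_pexp d P : polyd d P -> exists e, forall x y, P x y = ev e x y.
Proof.
  assert (Hpow : forall e n, exists e', forall x y, ev e' x y = ev e x y ^ n).
  { intros e n; induction n as [|n [e' IH]].
    - now exists (PC 1).
    - exists (PMul e e'); intros; simpl; now rewrite IH. }
  induction 1 as [c i j _|P Q _ [e He] _ [e' He']|P Q _ [e He] HPQ].
  - destruct (Hpow PX i) as [ex Hx], (Hpow PY j) as [ey Hy].
    exists (PMul (PMul (PC c) ex) ey); intros; simpl; now rewrite Hx, Hy.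
  - exists (PAdd e e'); intros; simpl; now rewrite He, He'.
  - exists e; intros; now rewrite HPQ.
Qed.

Lemma is_poly2_pexp P : is_poly2 P -> exists e, forall x y, P x y = ev e x y.
Proof. intros [d H]; exact (polyd_pexp d P (is_poly2_deg_polyd d P H)). Qed.

Lemma ev_continuity e x y : continuity_2d_pt (ev e) x y.
Proof.
  induction e; simpl.
  - apply continuity_2d_pt_const.
  - apply continuity_2d_pt_id1.
  - apply continuity_2d_pt_id2.
  - now apply continuity_2d_pt_plus.
  - now apply continuity_2d_pt_mult.
Qed.

Lemma ev_nonzero_near e x y :
  ev e x y <> 0 -> locally_2d (fun u v => ev e u v <> 0) x y.
Proof.
  intros H.
  destruct (ev_continuity e x y (mkposreal _ (Rabs_pos_lt _ H))) as [d Hd].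
  exists d; intros u v Hu Hv E; specialize (Hd u v Hu Hv); simpl in Hd.
  rewrite E, Rminus_0_l, Rabs_Ropp in Hd; lra.
Qed.

(** The chain rule is needed along curves because a horizontal line of the plane becomes a hyperbola
    u v = const in the blow-up chart. *)
Lemma is_derive_ev e (al be : R -> R) (t a b : R) :
  is_derive al t a -> is_derive be t b ->
  is_derive (fun s => ev e (al s) (be s)) t
    (ev (dX e) (al t) (be t) * a + ev (dY e) (al t) (be t) * b).
Proof.
  intros Ha Hb; induction e as [c| | |e1 IH1 e2 IH2|e1 IH1 e2 IH2]; simpl.
  - replace (0 * a + 0 * b) with 0 by ring; apply (is_derive_const c t).
  - replace (1 * a + 0 * b) with a by ring; exact Ha.
  - replace (0 * a + 1 * b) with b by ring; exact Hb.
  - evar_last; [exact (is_derive_plus _ _ _ _ _ IH1 IH2)|].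
    unfold plus; simpl; ring.
  - evar_last; [exact (is_derive_mult _ _ _ _ _ IH1 IH2 Rmult_comm)|].
    unfold plus, mult; simpl; ring.
Qed.

Lemma ev_divX e : exists e1, forall x y, ev e x y = ev e 0 y + x * ev e1 x y.
Proof.
  induction e as [c| | |e1 [f1 H1] e2 [f2 H2]|e1 [f1 H1] e2 [f2 H2]].
  - exists (PC 0); intros; simpl; ring.
  - exists (PC 1); intros; simpl; ring.
  - exists (PC 0); intros; simpl; ring.
  - exists (PAdd f1 f2); intros; simpl; rewrite (H1 x y), (H2 x y); ring.
  (* From e1 e2 = x f1 e2 + e1(0, y) e2, then expanding the second e2 as e2(0, y) + x f2. *)
  - exists (PAdd (PMul f1 e2) (PMul (psubst e1 (PC 0) PY) f2)); intros; simpl.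
    rewrite ev_psubst; simpl; rewrite (H1 x y), (H2 x y); ring.
Qed.

Lemma ev_continuity_x e y eps : 0 < eps -> exists eta, 0 < eta /\
  forall u, Rabs u < eta -> Rabs (ev e u y - ev e 0 y) < eps.
Proof.
  intros He; destruct (ev_continuity e 0 y (mkposreal eps He)) as [d Hd].
  exists d; split; [apply cond_pos|]; intros u Hu; apply Hd.
  - now rewrite Rminus_0_r.
  - rewrite Rminus_diag, Rabs_R0; apply cond_pos.
Qed.

(** * Order of vanishing of a polynomial along the line u = 0 *)

Definition small_o (k : nat) (g : R -> R) : Prop :=
  forall eps, 0 < eps -> exists eta, 0 < eta /\
    forall u, 0 < Rabs u < eta -> Rabs (g u) <= eps * Rabs u ^ k.

Lemma small_o_ev_0 e y : small_o 0 (fun u => ev e u y) -> ev e 0 y = 0.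
Proof.
  intros H; apply cond_eq; intros eps He; rewrite Rminus_0_r.
  destruct (H (eps / 2)) as [d [Hd H1]]; [lra|].
  destruct (ev_continuity_x e y (eps / 2)) as [d' [Hd' H2]]; [lra|].
  set (u := Rmin d d' / 2).
  assert (Hu : 0 < u /\ u < d /\ u < d').
  { unfold u; pose proof (Rmin_l d d'); pose proof (Rmin_r d d').
    pose proof (Rmin_glb_lt _ _ _ Hd Hd'); lra. }
  assert (Au : Rabs u = u) by (apply Rabs_pos_eq; lra).
  specialize (H1 u ltac:(lra)); specialize (H2 u ltac:(lra)); simpl in H1.
  replace (ev e 0 y) with (ev e u y + - (ev e u y - ev e 0 y)) by ring.
  eapply Rle_lt_trans; [apply Rabs_triang|]; rewrite Rabs_Ropp; lra.
Qed.

Lemma small_o_pred k g : small_o (S k) g -> small_o k g.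
Proof.
  intros H eps He; destruct (H eps He) as [d [Hd H1]].
  exists (Rmin d 1); split; [apply Rmin_glb_lt; lra|]; intros u Hu.
  pose proof (Rmin_l d 1); pose proof (Rmin_r d 1).
  eapply Rle_trans; [apply H1; lra|]; simpl.
  apply Rmult_le_compat_l; [lra|].
  pose proof (pow_le _ k (Rabs_pos u)); nra.
Qed.

(** A polynomial tending to 0 with u vanishes at u = 0 by continuity, so it has a factor u; dividing
    by u lowers the order by one. Starting from o(u^k), this can be done k + 1 times. The estimate
    is only pointwise in v, but the quotient is one polynomial for all of [V]. *)
Lemma small_o_ev_factor (V : R -> Prop) k e :
  (forall v, V v -> small_o k (fun u => ev e u v)) ->
  exists e', forall u v, V v -> ev e u v = u ^ S k * ev e' u v.
Proof.
  assert (Hstep : forall e', (forall v, V v -> small_o 0 (fun u => ev e' u v)) ->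
            exists e'', forall u v, V v -> ev e' u v = u * ev e'' u v).
  { intros e' H; destruct (ev_divX e') as [e'' H''].
    exists e''; intros u v Hv; rewrite H'', small_o_ev_0 by auto; ring. }
  induction k as [|k IH]; intros H.
  - destruct (Hstep e H) as [e' H']; exists e'.
    intros u v Hv; rewrite H' by assumption; ring.
  - destruct IH as [e' H'].
    { intros v Hv; apply small_o_pred; auto. }
    (* Dividing the o(u^(k+1)) bound by |u|^(k+1) shows that [e'] tends to 0, which yields the last
       factor. *)
    destruct (Hstep e') as [e'' H''].
    { intros v Hv eps He; destruct (H v Hv eps He) as [d [Hd Hu]].
      exists d; split; [assumption|]; intros u Hud; specialize (Hu u Hud).
      rewrite H', Rabs_mult, RPow_abs, Rmult_comm in Hu by assumption.
      simpl; rewrite Rmult_1_r.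
      apply (Rmult_le_reg_r (Rabs u ^ S k)); [now apply pow_lt|].
      rewrite RPow_abs; exact Hu. }
    exists e''; intros u v Hv; rewrite H', H'' by assumption; simpl; ring.
Qed.

(** * Germs of rational functions and of their pullbacks *)

Definition swap (g : R -> R -> R) (x y : R) : R := g y x.

(** The neighbourhood is Euclidean, which is what differentiation at a point sees. *)
Definition rat_germ (g : R -> R -> R) (x y : R) : Prop :=
  exists p q, ev q x y <> 0 /\
    locally_2d (fun u v => g u v = ev p u v / ev q u v) x y.

(* [g - Q] vanishes to order [m] along the exceptional divisor in the chart
   [(u, v) |-> (a1 + u, a2 + u v)] of the blowing-up at [(a1, a2)]. *)
Definition blow_germ (m : nat) (g : R -> R -> R) (Q : pexp) (a1 a2 : R) : Prop :=
  forall v0, exists p q, ev q 0 v0 <> 0 /\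
    locally_2d (fun u v => g (a1 + u) (a2 + u * v)
      = ev Q u (u * v) + u ^ m * (ev p u v / ev q u v)) 0 v0.

(** The invariant of the induction on derivatives. The second chart at (a1, a2) is encoded as the
    first chart of [swap g] at (a2, a1); both charts share the same polynomial [Q]. *)
Definition blow_class (m : nat) (g : R -> R -> R) : Prop :=
  forall a1 a2, rat_germ g a1 a2 \/
    exists Q, blow_germ m g Q a1 a2 /\ blow_germ m (swap g) (pswap Q) a2 a1.

Definition Dx (g : R -> R -> R) (x y : R) : R := Derive (fun t => g t y) x.
Definition Dy (g : R -> R -> R) (x y : R) : R := Derive (fun t => g x t) y.

Lemma rat_germ_swap g x y : rat_germ g x y -> rat_germ (swap g) y x.
Proof.
  intros [p [q [Hq H]]]; exists (pswap p), (pswap q).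
  rewrite ev_pswap; split; [assumption|].
  destruct H as [d H]; exists d; intros u v Hu Hv.
  rewrite !ev_pswap; now apply H.
Qed.

Lemma locally_2d_curve (P : R -> R -> Prop) (al be : R -> R) (t : R) :
  ex_derive al t -> ex_derive be t -> locally_2d P (al t) (be t) ->
  locally t (fun s => P (al s) (be s)).
Proof.
  intros Ha Hb [d H].
  apply ex_derive_continuous in Ha; apply ex_derive_continuous in Hb.
  specialize (Ha _ (locally_ball (al t) d)); specialize (Hb _ (locally_ball (be t) d)).
  unfold filtermap in Ha, Hb.
  generalize (filter_and _ _ Ha Hb); apply filter_imp; intros s [Hs Hs'].
  now apply H.
Qed.

(** Numerators of the partial derivatives of p / q over the denominator q^2. *)
Definition pdX (p q : pexp) : pexp :=
  PAdd (PMul (dX p) q) (PMul (PC (-1)) (PMul p (dX q))).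
Definition pdY (p q : pexp) : pexp :=
  PAdd (PMul (dY p) q) (PMul (PC (-1)) (PMul p (dY q))).

Lemma is_derive_ratio p q (al be : R -> R) (t a b : R) :
  is_derive al t a -> is_derive be t b -> ev q (al t) (be t) <> 0 ->
  is_derive (fun s => ev p (al s) (be s) / ev q (al s) (be s)) t
    (ev (pdX p q) (al t) (be t) / ev (PMul q q) (al t) (be t) * a
     + ev (pdY p q) (al t) (be t) / ev (PMul q q) (al t) (be t) * b).
Proof.
  intros Ha Hb Hq.
  evar_last.
  { exact (is_derive_div _ _ _ _ _ (is_derive_ev p _ _ _ _ _ Ha Hb)
             (is_derive_ev q _ _ _ _ _ Ha Hb) Hq). }
  simpl; field; exact Hq.
Qed.

Lemma rat_germ_continuity g x y : rat_germ g x y -> continuity_2d_pt g x y.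
Proof.
  intros [p [q [Hq H]]].
  apply (continuity_2d_pt_ext_loc (fun u v => ev p u v * / ev q u v)).
  - revert H; apply locally_2d_impl, locally_2d_forall; intros u v E; now rewrite E.
  - apply continuity_2d_pt_mult; [apply ev_continuity|].
    apply continuity_2d_pt_inv; [apply ev_continuity|exact Hq].
Qed.

Lemma rat_germ_derive_x g x y : rat_germ g x y ->
  ex_derive (fun t => g t y) x /\ rat_germ (Dx g) x y.
Proof.
  intros [p [q [Hq H]]].
  assert (D : locally_2d (fun u v => is_derive (fun t => g t v) u
                (ev (pdX p q) u v / ev (PMul q q) u v)) x y).
  { generalize (locally_2d_and _ _ _ _ H (ev_nonzero_near q x y Hq)).
    (* The strong form keeps a whole neighbourhood of each nearby (u, v) on which g = p / q, as
       differentiating at (u, v) requires. *)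
    apply locally_2d_impl_strong, locally_2d_forall; intros u v L.
    destruct (locally_2d_singleton _ _ _ L) as [_ Hq'].
    apply (is_derive_ext_loc (fun t => ev p t v / ev q t v)).
    - apply (locally_2d_curve (fun a b => ev p a b / ev q a b = g a b)
               (fun t => t) (fun _ => v)); try (auto_derive; trivial).
      revert L; apply locally_2d_impl, locally_2d_forall; intros a b [E _]; now rewrite E.
    - evar_last.
      { apply (is_derive_ratio p q (fun t => t) (fun _ => v) u 1 0);
          [exact (is_derive_id u)|exact (is_derive_const v u)|exact Hq']. }
      cbv beta; ring. }
  split.
  - exists (ev (pdX p q) x y / ev (PMul q q) x y).
    exact (locally_2d_singleton _ _ _ D).
  - exists (pdX p q), (PMul q q); split.
    + simpl; now apply Rmult_integral_contrapositive_currified.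
    + revert D; apply locally_2d_impl, locally_2d_forall; intros u v D.
      now apply is_derive_unique.
Qed.

Lemma rat_germ_derive_y g x y : rat_germ g x y ->
  ex_derive (fun t => g x t) y /\ rat_germ (Dy g) x y.
Proof.
  intros H; destruct (rat_germ_derive_x _ _ _ (rat_germ_swap _ _ _ H)) as [D G].
  split; [exact D|exact (rat_germ_swap _ _ _ G)].
Qed.

(** [ga] stands for the product u v, kept as a separate curve because it equals y - a2, which is
    constant or affine along coordinate lines. *)
Lemma is_derive_blow m Q p q (al be ga : R -> R) (t a b c : R) :
  is_derive al t a -> is_derive be t b -> is_derive ga t c ->
  ev q (al t) (be t) <> 0 ->
  is_derive (fun s => ev Q (al s) (ga s)
      + al s ^ S m * (ev p (al s) (be s) / ev q (al s) (be s))) t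
    (ev (dX Q) (al t) (ga t) * a + ev (dY Q) (al t) (ga t) * c
     + (INR (S m) * a * al t ^ m * (ev p (al t) (be t) / ev q (al t) (be t))
        + al t ^ S m *
          (ev (pdX p q) (al t) (be t) / ev (PMul q q) (al t) (be t) * a
           + ev (pdY p q) (al t) (be t) / ev (PMul q q) (al t) (be t) * b))).
Proof.
  intros Ha Hb Hc Hq.
  exact (is_derive_plus _ _ _ _ _ (is_derive_ev Q _ _ _ _ _ Ha Hc)
    (is_derive_mult _ _ _ _ _ (is_derive_pow _ (S m) _ _ Ha)
       (is_derive_ratio p q _ _ _ _ _ Ha Hb Hq) Rmult_comm)).
Qed.

(** The horizontal line through the centre is v = 0 in the chart. There the remainder carries
    u^(m+1) with m + 1 at least 2, so only [Q] contributes to the derivative. *)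
Lemma blow_germ_derive_center_x m g Q a1 a2 :
  (0 < m)%nat -> blow_germ (S m) g Q a1 a2 ->
  is_derive (fun t => g t a2) a1 (ev (dX Q) 0 0).
Proof.
  intros Hm H; destruct (H 0) as [p [q [Hq E]]].
  assert (Ha : is_derive (fun t => t - a1) a1 1) by (auto_derive; [trivial|ring]).
  assert (Z : a1 - a1 = 0) by ring.
  eapply (is_derive_ext_loc (fun t => ev Q (t - a1) 0
            + (t - a1) ^ S m * (ev p (t - a1) 0 / ev q (t - a1) 0))).
  - assert (L : locally a1 (fun t => g (a1 + (t - a1)) (a2 + (t - a1) * 0)
                 = ev Q (t - a1) ((t - a1) * 0)
                   + (t - a1) ^ S m * (ev p (t - a1) 0 / ev q (t - a1) 0))).
    { apply (locally_2d_curve (fun u v => g (a1 + u) (a2 + u * v)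
          = ev Q u (u * v) + u ^ S m * (ev p u v / ev q u v))
          (fun t => t - a1) (fun _ => 0)); try (auto_derive; trivial).
      rewrite Z; exact E. }
    revert L; apply filter_imp; intros t Et.
    rewrite Rmult_0_r in Et; rewrite <- Et.
    f_equal; ring.
  - evar_last.
    { apply (is_derive_blow m Q p q (fun t => t - a1) (fun _ => 0) (fun _ => 0)
               a1 1 0 0 Ha); try exact (is_derive_const 0 a1).
      rewrite Z; exact Hq. }
    cbv beta; rewrite Z, !pow_i by lia; ring.
Qed.

Lemma blow_germ_derive_center_y m g Q a1 a2 :
  (0 < m)%nat -> blow_germ (S m) (swap g) (pswap Q) a2 a1 ->
  is_derive (fun t => g a1 t) a2 (ev (dY Q) 0 0).
Proof.
  intros Hm H; pose proof (blow_germ_derive_center_x _ _ _ _ _ Hm H) as D.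
  rewrite dX_pswap, ev_pswap in D; exact D.
Qed.

(* With [g - Q = u^(m+1) G(u, v)] and [v = y/x], one has
   [(g - Q)_x = u^m ((m+1) G + u G_u - v G_v)]. *)
Lemma blow_germ_Dx m g Q a1 a2 :
  (0 < m)%nat -> blow_germ (S m) g Q a1 a2 -> blow_germ m (Dx g) (dX Q) a1 a2.
Proof.
  intros Hm H v0.
  pose proof (blow_germ_derive_center_x _ _ _ _ _ Hm H) as HC.
  destruct (H v0) as [p [q [Hq E]]].
  (* The numerator of (m+1) G + u G_u - v G_v over q^2, for G = p / q. *)
  exists (PAdd (PMul (PC (INR (S m))) (PMul p q))
           (PAdd (PMul PX (pdX p q)) (PMul (PC (-1)) (PMul PY (pdY p q))))),
         (PMul q q).
  split; [simpl; now apply Rmult_integral_contrapositive_currified|].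
  generalize (locally_2d_and _ _ _ _ E (ev_nonzero_near q 0 v0 Hq)).
  apply locally_2d_impl_strong, locally_2d_forall; intros u v L.
  destruct (locally_2d_singleton _ _ _ L) as [_ Hq'].
  destruct (Req_dec u 0) as [->|Hu].
  (* The whole line u = 0 maps to the centre, so the identity there is the value of the derivative
     at that one point. *)
  - rewrite Rmult_0_l, !Rplus_0_r, pow_i by assumption.
    transitivity (ev (dX Q) 0 0); [exact (is_derive_unique _ _ _ HC)|ring].
  - apply is_derive_unique.
    assert (Ha : is_derive (fun t => t - a1) (a1 + u) 1)
      by (auto_derive; [trivial|ring]).
    assert (Z : a1 + u - a1 = u) by ring.
    (* With y fixed, the chart coordinate v moves along u v / (t - a1); its slope -v/u is where one
       power of u is lost. *)
    assert (Hb : is_derive (fun t => u * v / (t - a1)) (a1 + u) (- (v / u))).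
    { auto_derive; replace (a1 + u + - a1) with u by ring;
        [assumption|field; assumption]. }
    assert (W : u * v / u = v) by (field; assumption).
    eapply (is_derive_ext_loc (fun t => ev Q (t - a1) (u * v)
      + (t - a1) ^ S m * (ev p (t - a1) (u * v / (t - a1))
                          / ev q (t - a1) (u * v / (t - a1))))).
    + assert (L1 : locally (a1 + u) (fun t =>
         g (a1 + (t - a1)) (a2 + (t - a1) * (u * v / (t - a1)))
         = ev Q (t - a1) ((t - a1) * (u * v / (t - a1)))
           + (t - a1) ^ S m * (ev p (t - a1) (u * v / (t - a1))
                               / ev q (t - a1) (u * v / (t - a1))))).
      { apply (locally_2d_curve (fun u v => g (a1 + u) (a2 + u * v)
          = ev Q u (u * v) + u ^ S m * (ev p u v / ev q u v))
          (fun t => t - a1) (fun t => u * v / (t - a1)));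
          [eexists; exact Ha|eexists; exact Hb|].
        rewrite Z, W.
        revert L; apply locally_2d_impl, locally_2d_forall; now intros ? ? []. }
      assert (L2 : locally (a1 + u) (fun t => t - a1 <> 0)).
      { apply (locally_2d_curve (fun a _ => ev PX a 0 <> 0) (fun t => t - a1)
                 (fun _ => 0)); [eexists; exact Ha|auto_derive; trivial|].
        rewrite Z; destruct (ev_nonzero_near PX u 0 Hu) as [d Hd].
        exists d; intros a b Ha' _; apply (Hd a 0 Ha').
        rewrite Rminus_diag, Rabs_R0; apply cond_pos. }
      generalize (filter_and _ _ L1 L2); apply filter_imp; intros t [Et Ht].
      replace ((t - a1) * (u * v / (t - a1))) with (u * v) in Et
        by (field; assumption).
      rewrite <- Et; f_equal; ring.
    + evar_last.
      { apply (is_derive_blow m Q p q (fun t => t - a1)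
                 (fun t => u * v / (t - a1)) (fun _ => u * v)
                 (a1 + u) 1 (- (v / u)) 0 Ha Hb (is_derive_const (u * v) _)).
        rewrite Z, W; exact Hq'. }
      cbv beta; rewrite Z, W; cbn -[INR pow].
      rewrite <- tech_pow_Rmult; field; auto.
Qed.

(** Since v = (y - a2) / u, here (g - Q)_y = u^m G_v. The derivative at the centre is a hypothesis
    because the vertical line through the centre is not seen by this chart; it comes from the other
    one. *)
Lemma blow_germ_Dy m g Q a1 a2 :
  (0 < m)%nat -> blow_germ (S m) g Q a1 a2 ->
  is_derive (fun t => g a1 t) a2 (ev (dY Q) 0 0) ->
  blow_germ m (Dy g) (dY Q) a1 a2.
Proof.
  intros Hm H HC v0; destruct (H v0) as [p [q [Hq E]]].
  exists (pdY p q), (PMul q q).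
  split; [simpl; now apply Rmult_integral_contrapositive_currified|].
  generalize (locally_2d_and _ _ _ _ E (ev_nonzero_near q 0 v0 Hq)).
  apply locally_2d_impl_strong, locally_2d_forall; intros u v L.
  destruct (locally_2d_singleton _ _ _ L) as [_ Hq'].
  destruct (Req_dec u 0) as [->|Hu].
  - rewrite Rmult_0_l, !Rplus_0_r, pow_i by assumption.
    transitivity (ev (dY Q) 0 0); [exact (is_derive_unique _ _ _ HC)|ring].
  - apply is_derive_unique.
    assert (Z : a2 + u * v - a2 = u * v) by ring.
    assert (W : u * v / u = v) by (field; assumption).
    assert (Ha : is_derive (fun _ => u) (a2 + u * v) 0)
      by exact (is_derive_const u _).
    assert (Hb : is_derive (fun t => (t - a2) / u) (a2 + u * v) (/ u)).
    { auto_derive; [trivial|field; assumption]. }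
    assert (Hc : is_derive (fun t => t - a2) (a2 + u * v) 1)
      by (auto_derive; [trivial|ring]).
    eapply (is_derive_ext_loc (fun t => ev Q u (t - a2)
      + u ^ S m * (ev p u ((t - a2) / u) / ev q u ((t - a2) / u)))).
    + assert (L1 : locally (a2 + u * v) (fun t =>
         g (a1 + u) (a2 + u * ((t - a2) / u))
         = ev Q u (u * ((t - a2) / u))
           + u ^ S m * (ev p u ((t - a2) / u) / ev q u ((t - a2) / u)))).
      { apply (locally_2d_curve (fun u v => g (a1 + u) (a2 + u * v)
          = ev Q u (u * v) + u ^ S m * (ev p u v / ev q u v))
          (fun _ => u) (fun t => (t - a2) / u));
          [eexists; exact Ha|eexists; exact Hb|].
        rewrite Z, W.
        revert L; apply locally_2d_impl, locally_2d_forall; now intros ? ? []. }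
      revert L1; apply filter_imp; intros t Et.
      replace (u * ((t - a2) / u)) with (t - a2) in Et by (field; assumption).
      rewrite <- Et; f_equal; ring.
    + evar_last.
      { apply (is_derive_blow m Q p q (fun _ => u) (fun t => (t - a2) / u)
                 (fun t => t - a2) (a2 + u * v) 0 (/ u) 1 Ha Hb Hc).
        rewrite Z, W; exact Hq'. }
      cbv beta; rewrite Z, W; cbn -[INR pow].
      rewrite <- tech_pow_Rmult; field; auto.
Qed.

Lemma blow_class_derive m g : (0 < m)%nat -> blow_class (S m) g ->
  (forall x y, ex_derive (fun t => g t y) x) /\
  (forall x y, ex_derive (fun t => g x t) y) /\
  blow_class m (Dx g) /\ blow_class m (Dy g).
Proof.
  intros Hm H.
  split; [|split; [|split]]; intros x y;
    (destruct (H x y) as [G|[Q [G1 G2]]];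
     [pose proof (rat_germ_derive_x _ _ _ G) as [? ?];
      pose proof (rat_germ_derive_y _ _ _ G) as [? ?]; auto|
      pose proof (blow_germ_derive_center_x _ _ _ _ _ Hm G1) as C1;
      pose proof (blow_germ_derive_center_y _ _ _ _ _ Hm G2) as C2]).
  - eexists; exact C1.
  - eexists; exact C2.
  - right; exists (dX Q); split; [now apply blow_germ_Dx|].
    (* By conversion [swap (Dx g)] is [Dy (swap g)]; the derivative at the centre is supplied by the
       first chart. *)
    rewrite <- dY_pswap; apply (blow_germ_Dy m (swap g)); try assumption.
    rewrite dY_pswap, ev_pswap; exact C1.
  - right; exists (dY Q); split; [now apply blow_germ_Dy|].
    rewrite <- dX_pswap; now apply (blow_germ_Dx m (swap g)).
Qed.

(** * Differentiability class of germs vanishing on the exceptional divisor *)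

Lemma blow_germ_near m g Q a1 a2 v0 eps :
  (0 < m)%nat -> blow_germ m g Q a1 a2 -> 0 < eps ->
  locally_2d (fun u v =>
    Rabs (g (a1 + u) (a2 + u * v) - ev Q u (u * v)) < eps) 0 v0.
Proof.
  intros Hm H He; destruct (H v0) as [p [q [Hq E]]].
  assert (Hpow : forall n, continuity_2d_pt (fun u _ => u ^ n) 0 v0).
  { induction n as [|n IH]; simpl.
    - apply continuity_2d_pt_const.
    - apply continuity_2d_pt_mult; [apply continuity_2d_pt_id1|exact IH]. }
  assert (C : continuity_2d_pt (fun u v => u ^ m * (ev p u v * / ev q u v)) 0 v0).
  { apply continuity_2d_pt_mult; [apply Hpow|].
    apply continuity_2d_pt_mult; [apply ev_continuity|].
    apply continuity_2d_pt_inv; [apply ev_continuity|exact Hq]. }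
  generalize (locally_2d_and _ _ _ _ E (C (mkposreal eps He))).
  apply locally_2d_impl, locally_2d_forall; intros u v [E1 E2]; simpl in E2.
  rewrite pow_i, Rmult_0_l, Rminus_0_r in E2 by assumption.
  rewrite E1; unfold Rdiv.
  match goal with |- Rabs ?z < _ =>
    replace z with (u ^ m * (ev p u v * / ev q u v)) by ring end.
  exact E2.
Qed.

(** The cone is the image of the strip where v lies in [-1, 1], and compactness of this interval
    makes the local radii of [blow_germ_near] uniform. *)
Lemma blow_germ_cone m g Q a1 a2 eps :
  (0 < m)%nat -> blow_germ m g Q a1 a2 -> 0 < eps ->
  exists delta, 0 < delta /\ forall h1 h2,
    Rabs h2 <= Rabs h1 -> Rabs h1 < delta ->
    Rabs (g (a1 + h1) (a2 + h2) - ev Q h1 h2) < eps.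
Proof.
  intros Hm H He.
  destruct (functional_choice (fun v0 (d : posreal) => forall u v, Rabs (u - 0) < d ->
      Rabs (v - v0) < d ->
      Rabs (g (a1 + u) (a2 + u * v) - ev Q u (u * v)) < eps)) as [D HD].
  { intros v0; exact (blow_germ_near m g Q a1 a2 v0 eps Hm H He). }
  destruct (compactness_value_1d (-1) 1 D) as [d Hd].
  exists d; split; [apply cond_pos|]; intros h1 h2 Hle Hh.
  assert (Hv : exists v, -1 <= v <= 1 /\ h2 = h1 * v).
  { destruct (Req_dec h1 0) as [->|N].
    - exists 0; split; [lra|].
      rewrite Rabs_R0 in Hle; pose proof (Rabs_pos h2).
      destruct (Req_dec h2 0) as [->|N]; [ring|].
      pose proof (Rabs_pos_lt _ N); lra.
    - exists (h2 / h1); split; [|field; assumption].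
      apply Rabs_le_between; rewrite Rabs_div by assumption.
      apply Rle_div_l; [now apply Rabs_pos_lt|lra]. }
  destruct Hv as [v [Hv ->]].
  (* The compactness statement gives a doubly negated existence, hence the argument by
     contradiction. *)
  apply Rnot_le_lt; intros Habs; apply (Hd v Hv).
  intros [t [_ [Ht1 Ht2]]]; apply (Rle_not_lt _ _ Habs), (HD t); [|exact Ht1].
  rewrite Rminus_0_r; lra.
Qed.

(** The cones of the two charts cover a neighbourhood of the centre, so g - Q is small there, and
    [Q] is continuous with Q(0, 0) = g(a). *)
Lemma blow_class_cont2 m g : (0 < m)%nat -> blow_class m g -> cont2 g.
Proof.
  intros Hm H x y eps He; destruct (H x y) as [G|[Q [G1 G2]]].
  { destruct (rat_germ_continuity _ _ _ G (mkposreal eps He)) as [d Hd].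
    exists d; split; [apply cond_pos|exact Hd]. }
  destruct (blow_germ_cone _ _ _ _ _ (eps / 2) Hm G1) as [d1 [Hd1 K1]]; [lra|].
  destruct (blow_germ_cone _ _ _ _ _ (eps / 2) Hm G2) as [d2 [Hd2 K2]]; [lra|].
  assert (He2 : 0 < eps / 2) by lra.
  destruct (ev_continuity Q 0 0 (mkposreal _ He2)) as [d3 K3]; simpl in K3.
  assert (E : g x y = ev Q 0 0).
  { destruct (G1 0) as [p [q [_ L]]].
    pose proof (locally_2d_singleton _ _ _ L) as L'; cbv beta in L'.
    rewrite Rmult_0_l, !Rplus_0_r, pow_i in L' by assumption; rewrite L'; ring. }
  exists (Rmin (Rmin d1 d2) d3); split.
  { repeat apply Rmin_glb_lt; try assumption; apply cond_pos. }
  intros x' y' Hx Hy.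
  pose proof (Rmin_l (Rmin d1 d2) d3); pose proof (Rmin_r (Rmin d1 d2) d3).
  pose proof (Rmin_l d1 d2); pose proof (Rmin_r d1 d2).
  set (h1 := x' - x) in *; set (h2 := y' - y) in *.
  assert (K : Rabs (g x' y' - ev Q h1 h2) < eps / 2).
  { replace x' with (x + h1) by (unfold h1; ring).
    replace y' with (y + h2) by (unfold h2; ring).
    destruct (Rle_dec (Rabs h2) (Rabs h1)) as [L|L].
    - apply K1; lra.
    - rewrite <- ev_pswap; apply (K2 h2 h1); lra. }
  assert (K' : Rabs (ev Q h1 h2 - ev Q 0 0) < eps / 2).
  { apply K3; rewrite Rminus_0_r; lra. }
  rewrite E.
  replace (g x' y' - ev Q 0 0)
    with ((g x' y' - ev Q h1 h2) + (ev Q h1 h2 - ev Q 0 0)) by ring.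
  eapply Rle_lt_trans; [apply Rabs_triang|lra].
Qed.

(** From exponent k + 1, each of the k derivatives takes one away; the exponent 1 that is left still
    gives continuity. *)
Lemma blow_class_Ck k g : blow_class (S k) g -> Ck k g.
Proof.
  revert g; induction k as [|k IH]; intros g H.
  - exact (blow_class_cont2 1 g Nat.lt_0_1 H).
  - destruct (blow_class_derive (S k) g) as [D1 [D2 [C1 C2]]];
      [lia|assumption|].
    split; [apply (blow_class_cont2 (S (S k))); [lia|assumption]|].
    exists (Dx g), (Dy g); split; [|split; [|split; auto]];
      intros x y; apply is_derive_Reals, Derive_correct; auto.
Qed.

(** * From the polynomial expansion to the order of vanishing *)

(** Ensures that points close to the exceptional line of one centre lie in the chart domain, away
    from the other centres. *)
Lemma finite_isolated (S : list (R * R)) (a1 a2 : R) :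
  locally_2d (fun x y => forall b, In b S -> b <> (a1, a2) -> (x, y) <> b) a1 a2.
Proof.
  induction S as [|[b1 b2] S IH]; simpl.
  - apply locally_2d_forall; intros x y b [].
  - assert (L : locally_2d (fun x y => (b1, b2) <> (a1, a2) -> (x, y) <> (b1, b2)) a1 a2).
    { destruct (Req_dec b1 a1) as [->|N1]; [destruct (Req_dec b2 a2) as [->|N2]|].
      - apply locally_2d_forall; congruence.
      - exists (mkposreal _ (Rabs_pos_lt _ (Rminus_eq_contra _ _ N2))); simpl.
        intros u v _ Hv _ [= _ ->]; lra.
      - exists (mkposreal _ (Rabs_pos_lt _ (Rminus_eq_contra _ _ N1))); simpl.
        intros u v Hu _ _ [= -> _]; lra. }
    generalize (locally_2d_and _ _ _ _ L IH).
    apply locally_2d_impl, locally_2d_forall; intros x y [H1 H2] b [<-|Hb]; auto.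
Qed.

Lemma regular_on_rat_germ (U : R -> R -> Prop) g x y :
  regular_on U g -> locally_2d U x y -> rat_germ g x y.
Proof.
  intros HR HU; pose proof (locally_2d_singleton _ _ _ HU) as Hxy.
  destruct (HR x y Hxy) as [p [q [r [Hp [Hq [Hr [Nr E]]]]]]].
  destruct (is_poly2_pexp p Hp) as [ep Ep], (is_poly2_pexp q Hq) as [eq Eq],
    (is_poly2_pexp r Hr) as [er Er].
  exists ep, eq; split.
  - rewrite <- Eq; now apply E.
  - rewrite Er in Nr.
    generalize (locally_2d_and _ _ _ _ HU (ev_nonzero_near er x y Nr)).
    apply locally_2d_impl, locally_2d_forall; intros u v [Hu Hv].
    rewrite <- Ep, <- Eq; rewrite <- Er in Hv; now apply E.
Qed.

Lemma locally_2d_comp (P : R -> R -> Prop) (e1 e2 : pexp) x y :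
  locally_2d P (ev e1 x y) (ev e2 x y) ->
  locally_2d (fun u v => P (ev e1 u v) (ev e2 u v)) x y.
Proof.
  intros [d H].
  generalize (locally_2d_and _ _ _ _ (ev_continuity e1 x y d) (ev_continuity e2 x y d)).
  apply locally_2d_impl, locally_2d_forall; intros u v [H1 H2]; now apply H.
Qed.

Lemma blow_germ_of_expansion k g Q a1 a2 :
  (forall v0, rat_germ (fun u v => g (a1 + u) (a2 + u * v)) 0 v0) ->
  (forall eps, 0 < eps -> exists delta, 0 < delta /\
     forall h1 h2, 0 < norm2 h1 h2 < delta ->
       Rabs (g (a1 + h1) (a2 + h2) - ev Q h1 h2) <= eps * norm2 h1 h2 ^ k) ->
  blow_germ (S k) g Q a1 a2.
Proof.
  intros HG HE v0; destruct (HG v0) as [p [q [Hq E]]].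
  destruct (locally_2d_and _ _ _ _ E (ev_nonzero_near q 0 v0 Hq)) as [d Hd].
  (* Numerator of the pullback of g - Q, which is to be divided by u^(k+1). *)
  set (n := PAdd p (PMul (PC (-1)) (PMul (psubst Q PX (PMul PX PY)) q))).
  assert (En : forall u v, Rabs (u - 0) < d -> Rabs (v - v0) < d ->
            ev n u v = (g (a1 + u) (a2 + u * v) - ev Q u (u * v)) * ev q u v).
  { intros u v Hu Hv; destruct (Hd u v Hu Hv) as [-> Hq']; unfold n; simpl.
    rewrite ev_psubst; simpl; field; exact Hq'. }
  destruct (small_o_ev_factor (fun v => Rabs (v - v0) < d) k n) as [e He].
  { intros v Hv eps Heps.
    destruct (ev_continuity_x q v 1 Rlt_0_1) as [d1 [Hd1 B]].
    (* [M] bounds |q(u, v)| for small u, and (u, u v) has norm |u| [L]; applying the expansion with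
       eps / (M L^k) bounds the numerator by eps |u|^k. *)
    set (M := Rabs (ev q 0 v) + 1); set (L := sqrt (1 + v ^ 2)).
    assert (HM : 0 < M) by (unfold M; pose proof (Rabs_pos (ev q 0 v)); lra).
    assert (HL : 0 < L) by (apply sqrt_lt_R0; nra).
    pose proof (pow_lt _ k HL) as HLk.
    destruct (HE (eps / (M * L ^ k))) as [d2 [Hd2 HE2]].
    { apply Rdiv_lt_0_compat; [assumption|now apply Rmult_lt_0_compat]. }
    exists (Rmin (Rmin d d1) (d2 / L)); split.
    { repeat apply Rmin_glb_lt; try assumption; [apply cond_pos|].
      now apply Rdiv_lt_0_compat. }
    intros u [Hu0 Hu].
    pose proof (Rmin_l (Rmin d d1) (d2 / L)); pose proof (Rmin_r (Rmin d d1) (d2 / L)).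
    pose proof (Rmin_l d d1); pose proof (Rmin_r d d1).
    assert (Nu : norm2 u (u * v) = Rabs u * L).
    { unfold norm2, L; replace (u ^ 2 + (u * v) ^ 2) with (u ^ 2 * (1 + v ^ 2)) by ring.
      rewrite sqrt_mult by nra; rewrite <- pow2_abs, sqrt_pow2 by apply Rabs_pos.
      reflexivity. }
    assert (HuL : Rabs u * L < d2).
    { apply Rlt_div_r; [assumption|lra]. }
    assert (Hn : 0 < norm2 u (u * v) < d2).
    { rewrite Nu; split; [now apply Rmult_lt_0_compat|assumption]. }
    specialize (HE2 _ _ Hn); rewrite Nu, Rpow_mult_distr in HE2.
    specialize (B u ltac:(lra)).
    assert (Bq : Rabs (ev q u v) <= M).
    { unfold M; replace (ev q u v) with (ev q 0 v + (ev q u v - ev q 0 v)) by ring.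
      eapply Rle_trans; [apply Rabs_triang|lra]. }
    rewrite En by (rewrite ?Rminus_0_r; lra); rewrite Rabs_mult.
    eapply Rle_trans.
    { apply Rmult_le_compat; [apply Rabs_pos|apply Rabs_pos|exact HE2|exact Bq]. }
    right; field; lra. }
  exists e, q; split; [assumption|].
  (* This includes u = 0, where the expansion says nothing: divisibility of the numerator by u
     forces g(a) = Q(0, 0). *)
  exists d; intros u v Hu Hv; destruct (Hd u v Hu Hv) as [_ Hq'].
  specialize (He u v Hv); rewrite En in He by assumption.
  apply (Rmult_eq_reg_r (ev q u v)); [|exact Hq'].
  replace ((ev Q u (u * v) + u ^ S k * (ev e u v / ev q u v)) * ev q u v)
    with (ev Q u (u * v) * ev q u v + u ^ S k * ev e u v) by (field; exact Hq').
  rewrite <- He; ring.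
Qed.

Lemma expansion_blow_class k S f : blowup_regular S f ->
  (forall a1 a2, has_poly_expansion k f a1 a2) -> blow_class (Datatypes.S k) f.
Proof.
  intros [R0 RS] HE a1 a2.
  set (far := fun x y => forall b, In b S -> b <> (a1, a2) -> (x, y) <> b).
  assert (HS : locally_2d far a1 a2) by exact (finite_isolated S a1 a2).
  destruct (classic (In (a1, a2) S)) as [Hin|Hout].
  - right; destruct (RS _ Hin) as [R1 R2]; simpl in R1, R2.
    destruct (HE a1 a2) as [P [HP E]].
    destruct (polyd_pexp k P (is_poly2_deg_polyd k P HP)) as [e He].
    exists (PAdd (PC (f a1 a2)) e); split; apply blow_germ_of_expansion.
    + intros v0; apply (regular_on_rat_germ _ _ _ _ R1).
      apply (locally_2d_comp far (PAdd (PC a1) PX) (PAdd (PC a2) (PMul PX PY))).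
      simpl; rewrite Rmult_0_l, !Rplus_0_r; exact HS.
    + intros eps Heps; destruct (E eps Heps) as [d [Hd H]].
      exists d; split; [assumption|]; intros h1 h2 Hh; simpl; rewrite <- He.
      specialize (H h1 h2 Hh).
      match goal with |- Rabs ?z <= _ =>
        replace z with (f (a1 + h1) (a2 + h2) - f a1 a2 - P h1 h2) by ring end.
      exact H.
    + intros v0.
      (* In the second chart the exceptional line is v = 0; swapping the chart coordinates turns it
         into u = 0 for [swap f]. *)
      assert (G : rat_germ (fun u v => f (a1 + u * v) (a2 + v)) v0 0).
      { apply (regular_on_rat_germ _ _ _ _ R2).
        apply (locally_2d_comp far (PAdd (PC a1) (PMul PX PY)) (PAdd (PC a2) PY)).
        simpl; rewrite Rmult_0_r, !Rplus_0_r; exact HS. }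
      destruct (rat_germ_swap _ _ _ G) as [p [q [Hq L]]].
      exists p, q; split; [assumption|].
      revert L; apply locally_2d_impl, locally_2d_forall; intros u v L.
      rewrite <- L; unfold swap; now rewrite Rmult_comm.
    + intros eps Heps; destruct (E eps Heps) as [d [Hd H]].
      exists d; split; [assumption|]; intros h1 h2 Hh.
      rewrite norm2_sym in Hh |- *; rewrite ev_pswap; simpl; rewrite <- He.
      specialize (H h2 h1 Hh); unfold swap.
      match goal with |- Rabs ?z <= _ =>
        replace z with (f (a1 + h2) (a2 + h1) - f a1 a2 - P h2 h1) by ring end.
      exact H.
  - left; apply (regular_on_rat_germ _ _ _ _ R0).
    revert HS; apply locally_2d_impl, locally_2d_forall; intros x y H Hin.
    apply (H _ Hin); [|reflexivity]; congruence.
Qed.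

Theorem theorem3p8 (k : nat) (f : R -> R -> R) (hf : regulous1 0 f) :
  regulous1 k f <-> (forall a1 a2 : R, has_poly_expansion k f a1 a2).
Proof.
  destruct hf as [[_ Hrat] [S HS]]; split.
  - intros [[HC _] _] a1 a2; now apply Ck_has_poly_expansion.
  (* Rationality and the set of centres are inherited from [hf]; only the class C^k has to be
     proved. *)
  - intros HE; split; [split|].
    + now apply blow_class_Ck, (expansion_blow_class k S).
    + exact Hrat.
    + now exists S.
Qed.
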